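(* Every infinite-dimensional normed space $X$ contains an infinite-dimensional closed subspace $Z$ with a Schauder basis $(x_n)_{n=1}^\infty$ for which the canonical projections $P_n : Z\to Z$, $n\in\mathbb{N}$, are bounded operators. Moreover, $\sup_n \Vert P_n\Vert < +\infty$.
   Context: Normed spaces are over the scalar field $\mathbb{K}$ (real or complex) and are not assumed complete. A sequence $(x_n)$ in a normed space $Z$ is a Schauder basis for $Z$ if for each $x\in Z$ there is a unique sequence of scalars $(a_n)$ with $x=\sum_{n=1}^\infty a_n x_n$ (norm convergence in $Z$). The canonical projections associated with the basis are the linear maps $P_n(\sum_{j=1}^\infty a_j x_j)=\sum_{j=1}^n a_j x_j$. *)

(* Defs.v *)
From HB Require Import structures.
From mathcomp Require Import all_boot all_order all_algebra complex.
From mathcomp Require Import all_classical all_reals.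
From mathcomp Require Import ereal topology normedtype sequences.

Set Implicit Arguments.
Unset Strict Implicit.
Unset Printing Implicit Defensive.

Import Order.TTheory GRing.Theory Num.Theory.
Import numFieldNormedType.Exports.

Local Open Scope classical_set_scope.
Local Open Scope ring_scope.

Variant scalar_kind := RealScalars | ComplexScalars.

Definition scalar_field (R : realType) (k : scalar_kind) : numFieldType :=
  match k with RealScalars => R | ComplexScalars => R[i] end.

Definition scalar_re (R : realType) (k : scalar_kind) : scalar_field R k -> R :=
  match k with RealScalars => id | ComplexScalars => @complex.Re R end.

(* The library norm of a normedModType K takes its values in K; [rnorm] is the
   same norm, read as an element of R (for complex scalars `|x| is a nonnegative
   real element of R[i], so taking its real part loses nothing). *)
Definition rnorm (R : realType) (k : scalar_kind)
  (X : normedModType (scalar_field R k)) (x : X) : R := scalar_re `|x|.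

Definition finite_dimensional (K : numFieldType) (X : lmodType K) (V : set X) :=
  exists (n : nat) (e : 'I_n -> X), (forall i, V (e i)) /\
    forall v, V v -> exists c : 'I_n -> K, v = \sum_(i < n) c i *: e i.

Definition infinite_dimensional (K : numFieldType) (X : lmodType K)
  (V : set X) := ~ finite_dimensional V.

Definition closed_subspace (K : numFieldType) (X : normedModType K)
  (Z : set X) := GRing.submod_closed [in Z] /\ closed Z.

(* Sequences are indexed from 0: [x 0] is the first basis vector. *)
Definition expansion (K : numFieldType) (X : normedModType K) (x : nat -> X)
  (a : nat -> K) (z : X) := series (fun j => a j *: x j) @ \oo --> z.

Definition schauder_basis (K : numFieldType) (X : normedModType K)
  (Z : set X) (x : nat -> X) :=
  (forall n, Z (x n)) /\
  forall z, Z z -> exists! a : nat -> K, expansion x a z.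

(* Meaningful when [x] is a Schauder basis of a subspace containing [z]. *)
Definition coordinates (K : numFieldType) (X : normedModType K)
  (x : nat -> X) (z : X) : nat -> K := get [set a | expansion x a z].

(* [canonical_projection x n] keeps the first n + 1 terms of the expansion,
   so that n ranging over nat gives the partial sums of length 1, 2, ... *)
Definition canonical_projection (K : numFieldType) (X : normedModType K)
  (x : nat -> X) (n : nat) (z : X) : X :=
  \sum_(j < n.+1) coordinates x z j *: x j.

(* [P] restricts to a bounded linear operator from Z to Z; its values outside Z
   are irrelevant. *)
Definition bounded_operator_on (R : realType) (k : scalar_kind)
  (X : normedModType (scalar_field R k)) (Z : set X) (P : X -> X) :=
  [/\ forall z, Z z -> Z (P z),
      forall (a : scalar_field R k) (u v : X), Z u -> Z v ->
        P (a *: u + v) = a *: P u + P v &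
      exists M : R, forall z, Z z -> rnorm (P z) <= M * rnorm z].

Definition operator_norm_on (R : realType) (k : scalar_kind)
  (X : normedModType (scalar_field R k)) (Z : set X) (P : X -> X) : \bar R :=
  ereal_sup [set (rnorm (P z))%:E | z in [set z | Z z /\ rnorm z <= 1]].

(* Main.v *)
Require Import Defs.
From mathcomp Require Import all_boot all_order all_algebra complex.
From mathcomp Require Import all_classical all_reals.
From mathcomp Require Import ereal topology normedtype sequences.
From mathcomp Require Import ring lra.

Import Order.TTheory GRing.Theory Num.Theory.
Import numFieldNormedType.Exports.
Local Open Scope classical_set_scope.
Local Open Scope ring_scope.

(** The argument is Mazur's construction of a basic sequence, arranged so that
    no completeness of the space is used.

    Suppose that the balls of a subspace F of X have finite nets.  A functional
    norming y, for each y in a finite net of the unit ball of F, gives finitely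
    many real functionals that together norm F up to a factor c < 1.  As X is
    infinite-dimensional, some line K x lies in all their kernels, so that
    c ||y|| <= ||y + l x|| for all y in F and all scalars l (mazur_step).  Then
    balls of F + K x have finite nets again (adjoin_precompact), and the step
    can be repeated.  Taking c_n = w_n / w_(n+1) with w_n increasing from 1
    to 2 makes the partial sums s_n of any linear combination satisfy
    w_n ||s_n|| <= w_(n+1) ||s_(n+1)||, whence ||s_n|| <= 2 ||s_m|| for n <= m
    (exists_basic_sequence).

    Such a basic sequence is a Schauder basis of its closed span Z inside X.
    The inequality bounds the coefficients, so when combinations converge to
    some z in Z their coefficients converge too, because the scalar field is
    complete; the uniform bound on partial sums shows that the limit
    coefficients expand z (expansion_exists).  The limit of the expansion thus
    never has to be produced: it is the given point z, and this is why X need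
    not be complete.  The same bound, passed to the limit, yields uniqueness
    and ||P_n|| <= 2.

    The norming functionals come from a form of the Hahn-Banach theorem proved
    with Zorn's lemma: a minimal sublinear functional is linear.  They are only
    real-linear; over the complex numbers f(x) - i f(i x) is the complex-linear
    functional whose kernel is used instead.  Everything else is uniform in
    the scalar field, through the embedding of R in it and the R-valued
    modulus. *)

(** * Norming functionals by Zorn's lemma *)

Section HahnBanach.
Set Implicit Arguments.
Unset Strict Implicit.
Variables (R : realType) (K : numFieldType) (iota : {rmorphism R -> K}).
Variable X : lmodType K.
Implicit Types (p q f : X -> R) (x y : X) (t : R).

(** Homogeneity is an inequality only; applied to t and to its inverse it gives
    the equality, see sublinearZ. *)
Definition sublinear p :=
  (forall x y, p (x + y) <= p x + p y) /\
  (forall t x, 0 < t -> p (iota t *: x) <= t * p x).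

Definition real_linear f :=
  (forall x y, f (x + y) = f x + f y) /\
  (forall t x, f (iota t *: x) = t * f x).

Lemma sublinear0 p : sublinear p -> p 0 = 0.
Proof.
move=> [pD pZ]; apply/eqP; rewrite eq_le; apply/andP; split.
- have := pZ 2^-1 0; rewrite scaler0 invr_gt0 ltr0n => /(_ isT); lra.
- by have := pD 0 0; rewrite addr0; lra.
Qed.

Lemma sublinearN p x : sublinear p -> - p (- x) <= p x.
Proof.
by move=> sp; have := sp.1 x (- x); rewrite subrr (sublinear0 sp); lra.
Qed.

Lemma sublinearZ p t x : sublinear p -> 0 <= t -> p (iota t *: x) = t * p x.
Proof.
move=> sp; rewrite le_eqVlt => /predU1P[<-|t0].
  by rewrite rmorph0 scale0r mul0r sublinear0.
apply/eqP; rewrite eq_le sp.2 //=.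
have tV : 0 < t^-1 by rewrite invr_gt0.
have := sp.2 t^-1 (iota t *: x) tV.
rewrite scalerA -rmorphM mulVf ?gt_eqF// rmorph1 scale1r.
by rewrite -(ler_pM2l t0) mulrA divff ?gt_eqF// mul1r.
Qed.

(** Both the infimum of a chain of sublinear functionals and the functional
    tilt below are pointwise infima; this isolates the part of the
    verification that they share. *)
Lemma sublinear_inf (E : X -> set R) :
    (forall x, E x !=set0) -> (forall x, has_lbound (E x)) ->
    (forall x y a b, E x a -> E y b -> exists2 c, E (x + y) c & c <= a + b) ->
    (forall t x a, 0 < t -> E x a ->
       exists2 c, E (iota t *: x) c & c <= t * a) ->
  sublinear (fun x => inf (E x)).
Proof.
move=> En Eb ED EZ; split=> [x y|t x t0].
  rewrite -lerBlDr; apply: lb_le_inf => // a Ea.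
  rewrite lerBlDr [a + _]addrC -lerBlDr; apply: lb_le_inf => // b Eb'.
  have [c Ec cab] := ED _ _ _ _ Ea Eb'.
  rewrite lerBlDr [b + _]addrC; apply: le_trans cab; exact: ge_inf.
rewrite mulrC -ler_pdivrMr//; apply: lb_le_inf => // a Ea.
have [c Ec cab] := EZ _ _ _ t0 Ea.
rewrite ler_pdivrMr// mulrC; apply: le_trans cab; exact: ge_inf.
Qed.

(** Zorn's lemma applies because a chain has a sublinear pointwise infimum:
    all its members are bounded below at x by - p (- x). *)
Lemma exists_minimal_sublinear p : sublinear p ->
  exists q, [/\ sublinear q, forall x, q x <= p x &
    forall q', sublinear q' -> (forall x, q' x <= q x) -> q' = q].
Proof.
move=> sp.
pose T := {q : X -> R | sublinear q /\ forall x, q x <= p x}.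
pose ge (q r : T) := `[< forall x, sval r x <= sval q x >].
have [|r s t|r s|A Atot|[q [sq qp]] qmin] := @Zorn T ge.
- by move=> q; apply/asboolP.
- by move=> /asboolP rs /asboolP st; apply/asboolP => x; apply: le_trans (rs x).
- move: r s => [r Pr] [s Ps] /asboolP/= rs /asboolP/= sr.
  have e : r = s by apply/funext => x; apply/le_anti; rewrite rs sr.
  by move: Pr Ps rs sr; rewrite e => Pr Ps _ _; rewrite (Prop_irrelevance Pr Ps).
- have [A0|/set0P[q0 Aq0]] := eqVneq A set0.
    pose m : T := exist _ p (conj sp (fun=> lexx _)).
    by exists m; rewrite A0 => s [].
  pose E x := [set sval q x | q in A].
  have Elb x : has_lbound (E x).
    exists (- p (- x)) => _ [[q [sq qp]] _ <-] /=.
    by apply: le_trans (sublinearN _ sq); rewrite lerN2.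
  have sE : sublinear (fun x => inf (E x)).
    apply: sublinear_inf => //.
    + by move=> x; exists (sval q0 x), q0.
    + move=> x y _ _ [q Aq <-] [r Ar <-].
      have [/asboolP qr|/asboolP rq] := Atot _ _ Aq Ar.
        exists (sval r (x + y)); first by exists r.
        by apply: le_trans ((svalP r).1.1 _ _) _; rewrite lerD2r.
      exists (sval q (x + y)); first by exists q.
      by apply: le_trans ((svalP q).1.1 _ _) _; rewrite lerD2l.
    + move=> t x _ t0 [q Aq <-]; exists (sval q (iota t *: x)); first by exists q.
      exact: (svalP q).1.2.
  have Ep x : inf (E x) <= p x.
    by apply: le_trans ((svalP q0).2 x); apply: ge_inf => //; exists q0.
  pose m : T := exist _ (fun x => inf (E x)) (conj sE Ep).
  exists m => s As; apply/asboolP => x /=.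
  by apply: ge_inf => //; exists s.
exists q; split=> // q' sq' q'q.
have q'p x : q' x <= p x by apply: le_trans (qp x).
pose m : T := exist _ q' (conj sq' q'p).
have := qmin m.
by move=> /(_ (asboolT q'q)) /(congr1 sval).
Qed.

(** The infimum over t >= 0 of q (x + t y) - t q y: the sublinear functional
    obtained by lowering q so that its value at - y is at most - q y. *)
Definition tilt_values q y x : set R :=
  [set q (x + iota t *: y) - t * q y | t in [set t | 0 <= t]].

Definition tilt q y x := inf (tilt_values q y x).

Lemma tilt_values_lbound q y x : sublinear q -> has_lbound (tilt_values q y x).
Proof.
move=> sq; exists (- q (- x)) => _ [t t0 <-].
have := sq.1 (x + iota t *: y) (- x).
rewrite [x + _]addrC addrK (sublinearZ _ sq t0); lra.
Qed.

Lemma tilt_sublinear q y : sublinear q -> sublinear (tilt q y).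
Proof.
move=> sq; apply: sublinear_inf.
- by move=> x; exists (q (x + iota 0 *: y) - 0 * q y), 0; rewrite //= lexx.
- by move=> x; exact: tilt_values_lbound.
- move=> x x' _ _ [t t0 <-] [t' t'0 <-].
  exists (q (x + x' + iota (t + t') *: y) - (t + t') * q y).
    by exists (t + t') => //=; exact: addr_ge0.
  rewrite rmorphD scalerDl addrACA.
  have := sq.1 (x + iota t *: y) (x' + iota t' *: y); lra.
- move=> s x _ s0 [t t0 <-].
  exists (q (iota s *: x + iota (s * t) *: y) - (s * t) * q y).
    by exists (s * t) => //=; rewrite mulr_ge0 // ltW.
  rewrite rmorphM -scalerA -scalerDr mulrBr mulrA lerD2r.
  exact: sq.2.
Qed.

Lemma tilt_le q y x : sublinear q -> tilt q y x <= q x.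
Proof.
move=> sq; apply: ge_inf; first exact: tilt_values_lbound.
by exists 0; rewrite //= rmorph0 scale0r addr0 mul0r subr0.
Qed.

Lemma tilt_opp q y : sublinear q -> tilt q y (- y) <= - q y.
Proof.
move=> sq; apply: ge_inf; first exact: tilt_values_lbound.
exists 1; rewrite //= rmorph1 scale1r mul1r addNr (sublinear0 sq) sub0r//.
Qed.

(** By minimality tilting changes nothing, so q (- y) <= - q y for all y, and
    a sublinear functional that is odd is linear. *)
Lemma minimal_sublinear_linear q : sublinear q ->
    (forall q', sublinear q' -> (forall x, q' x <= q x) -> q' = q) ->
  real_linear q.
Proof.
move=> sq qmin.
have qN y : q (- y) = - q y.
  apply/eqP; rewrite eq_le; apply/andP; split.
    have e := qmin _ (tilt_sublinear y sq) (fun x => tilt_le y x sq).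
    by have := tilt_opp y sq; rewrite e.
  have := sublinearN (- y) sq; rewrite opprK; lra.
split=> [x y|t x].
  apply/eqP; rewrite eq_le sq.1 /=.
  have := sq.1 (x + y) (- y); rewrite addrK qN; lra.
have [t0|t0] := leP 0 t; first exact: sublinearZ.
have := @sublinearZ q (- t) x sq; rewrite oppr_ge0 (ltW t0) => /(_ isT).
by rewrite rmorphN scaleNr qN mulNr => /oppr_inj.
Qed.

(** A minimal functional below tilt p y, not merely below p, is taken: its
    value at - y is at most - p y, which makes f touch p at y. *)
Theorem hahn_banach_support p y : sublinear p ->
  exists f, [/\ real_linear f, forall x, f x <= p x & f y = p y].
Proof.
move=> sp; have [f [sf fle fmin]] := exists_minimal_sublinear (tilt_sublinear y sp).
have lf := minimal_sublinear_linear sf fmin.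
have fp x : f x <= p x := le_trans (fle x) (tilt_le y x sp).
exists f; split => //; apply/eqP; rewrite eq_le fp /=.
have fN : f (- y) = - f y.
  by rewrite -scaleN1r -(rmorph1 iota) -rmorphN lf.2 mulN1r.
by rewrite -lerN2 -fN; apply: le_trans (fle _) (tilt_opp _ sp).
Qed.

End HahnBanach.

(** * Real and complex scalars treated alike *)

Section Scalars.
Set Implicit Arguments.
Unset Strict Implicit.
Variables (R : realType) (k : scalar_kind).
Local Notation K := (scalar_field R k).
Implicit Types (a b : K) (s t M e : R).

Definition embed : {rmorphism R -> K} :=
  match k return {rmorphism R -> scalar_field R k} with
  | RealScalars => idfun
  | ComplexScalars => real_complex R
  end.

Definition modulus a : R := scalar_re `|a|.

Lemma scalar_reK a : 0 <= a -> embed (scalar_re a) = a.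
Proof.
rewrite /embed /scalar_re; case: k a => //= a a0.
exact/RRe_real/ger0_real.
Qed.

Lemma ler_embed s t : (embed s <= embed t) = (s <= t).
Proof. by rewrite /embed; case: k => //=; rewrite lecR. Qed.

Lemma ltr_embed s t : (embed s < embed t) = (s < t).
Proof. by rewrite /embed; case: k => //=; rewrite ltcR. Qed.

Lemma embed_modulus a : embed (modulus a) = `|a|.
Proof. exact: scalar_reK. Qed.

Lemma modulus_embed t : modulus (embed t) = `|t|.
Proof.
rewrite /modulus /embed /scalar_re; case: k => //.
by rewrite (normc_def (t%:C)%C) /= expr0n addr0 sqrtr_sqr.
Qed.

(** Completeness in the form used here: the error r m bounds the distance to
    the limit directly.  The limit is the supremum of the lower bounds
    u n - r n. *)
Lemma real_complete (u r : nat -> R) :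
    (forall m n, `|u m - u n| <= r m + r n) ->
  exists l, forall m, `|u m - l| <= r m.
Proof.
move=> ur; pose E := [set u n - r n | n in [set: nat]].
have urE m n : u n - r n <= u m + r m.
  have := ur m n; rewrite ler_norml => /andP[]; lra.
have Eub m : ubound E (u m + r m) by move=> _ [n _ <-]; exact: urE.
exists (sup E) => m; rewrite ler_norml; apply/andP; split.
- have : sup E <= u m + r m.
    by apply: ge_sup => //; exists (u 0%N - r 0%N), 0%N.
  lra.
- have : u m - r m <= sup E.
    by apply: ub_le_sup; [exists (u 0%N + r 0%N) | exists m].
  lra.
Qed.

(** The net is the grid of mesh e that starts at - M. *)
Lemma real_net M e : 0 < e -> exists s : seq R, forall t, `|t| <= M ->
  exists2 y, y \in s & `|t - y| <= e.
Proof.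
move=> e0; pose N := Num.truncn (2 * M / e).
exists [seq i%:R * e - M | i <- iota 0 N.+1] => t; rewrite ler_norml => /andP[Mt tM].
pose i := Num.truncn ((t + M) / e).
have d0 : 0 <= (t + M) / e by apply: divr_ge0; [lra|exact: ltW].
have /andP[i1 i2] := truncn_itv d0.
exists (i%:R * e - M).
  apply/mapP; exists i => //; rewrite mem_iota /= add0n ltnS.
  apply: le_truncn; rewrite ler_pM2r ?invr_gt0//; lra.
move: i1 i2; rewrite ler_pdivlMr// ltr_pdivrMr// -/i -natr1 mulrDl mul1r => i1 i2.
rewrite ler_norml; lra.
Qed.

End Scalars.

Section ScalarField.
Set Implicit Arguments.
Unset Strict Implicit.
Variable R : realType.

Lemma complex_modulusE (z : R[i]) : modulus (k := ComplexScalars) z =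
  Num.sqrt (complex.Re z ^+ 2 + complex.Im z ^+ 2).
Proof. by rewrite /modulus [`|_|](normc_def z). Qed.

Lemma complex_modulus_le (z : R[i]) :
  modulus (k := ComplexScalars) z <= `|complex.Re z| + `|complex.Im z|.
Proof.
rewrite complex_modulusE -(ger0_norm (addr_ge0 (normr_ge0 _) (normr_ge0 _))).
rewrite -sqrtr_sqr ler_wsqrtr// sqrrD !real_normK ?num_real//.
rewrite addrAC lerDl mulrn_wge0// mulr_ge0//.
Qed.

Lemma Re_le_modulus (z : R[i]) :
  `|complex.Re z| <= modulus (k := ComplexScalars) z.
Proof.
rewrite complex_modulusE -sqrtr_sqr ler_wsqrtr// lerDl sqr_ge0//.
Qed.

Lemma Im_le_modulus (z : R[i]) :
  `|complex.Im z| <= modulus (k := ComplexScalars) z.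
Proof.
rewrite complex_modulusE -sqrtr_sqr ler_wsqrtr// lerDr sqr_ge0//.
Qed.

(** The factor 2 is the cost of adding the errors of the real and imaginary
    parts. *)
Lemma scalar_complete (k : scalar_kind) (u : nat -> scalar_field R k)
    (r : nat -> R) :
    (forall m n, modulus (u m - u n) <= r m + r n) ->
  exists l, forall m, modulus (u m - l) <= 2 * r m.
Proof.
case: k u => u ur.
  have [l ul] := real_complete ur; exists l => m.
  have := ul m; have := normr_ge0 (u m - l : R).
  rewrite /modulus /=; lra.
have [m n|x ux] := @real_complete _ (fun n => complex.Re (u n)) r.
  by apply: le_trans (ur m n); rewrite -raddfB Re_le_modulus.
have [m n|y uy] := @real_complete _ (fun n => complex.Im (u n)) r.
  by apply: le_trans (ur m n); rewrite -raddfB Im_le_modulus.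
exists (x +i* y)%C => m; apply: le_trans (complex_modulus_le _) _.
by rewrite !raddfB /= mulr2n mulrDl mul1r; exact: lerD.
Qed.

Lemma scalar_net (k : scalar_kind) (M e : R) : 0 < e ->
  exists s : seq (scalar_field R k), forall a, modulus a <= M ->
    exists2 b, b \in s & modulus (a - b) <= e.
Proof.
case: k => e0; first exact: real_net.
have [|s sP] := @real_net R M (e / 2); first by rewrite divr_gt0.
exists [seq (x +i* y)%C | x <- s, y <- s] => z zM.
have [x xs zx] := sP _ (le_trans (Re_le_modulus z) zM).
have [y ys zy] := sP _ (le_trans (Im_le_modulus z) zM).
exists (x +i* y)%C; first exact: allpairs_f.
apply: le_trans (complex_modulus_le _) _.
by rewrite !raddfB /= [leRHS]splitr; exact: lerD.
Qed.

(** A real functional f may vanish at x without vanishing on the line K x.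
    Over the complex numbers, f (x) - i f (i x) is linear and its vanishing at
    x gives both f x = 0 and f (i x) = 0, hence f = 0 on the whole line. *)
Lemma real_linear_kernel (k : scalar_kind) (X : lmodType (scalar_field R k))
    (f : X -> R) : real_linear (embed R k) f ->
  exists2 g : X -> scalar_field R k,
    forall a x y, g (a *: x + y) = a * g x + g y &
    forall x, g x = 0 -> forall a, f (a *: x) = 0.
Proof.
case: k X f => X f [fD fZ].
  exists f => [a x y|x fx0 a]; first by rewrite fD (fZ a).
  by rewrite (fZ a) fx0 mulr0.
have fZ' t x : f (t%:C%C *: x) = t * f x := fZ t x.
have fE (a : R[i]) x : f (a *: x) =
    complex.Re a * f x + complex.Im a * f ('i%C *: x).
  rewrite {1}[a]complexE scalerDl fD fZ'; congr (_ + _).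
  by rewrite mulrC -scalerA fZ'.
have fN x : f (- x) = - f x.
  by rewrite -scaleN1r fE /= oppr0 mul0r addr0 mulN1r.
exists (fun x => (f x -i* f ('i%C *: x))%C) => [a x y|x [fx0 fix0] a].
  rewrite scalerDr scalerA !fD fE (fE ('i%C * a)).
  case: a => p q; apply/eqP; rewrite eq_complex.
  by apply/andP; split; apply/eqP => /=; ring.
by rewrite fE fx0 (oppr_inj (etrans fix0 (esym (oppr0 R)))) !mulr0 addr0.
Qed.

End ScalarField.

(** * Infinite dimension and kernels *)

Section Kernels.
Set Implicit Arguments.
Unset Strict Implicit.
Variables (K : numFieldType) (X : lmodType K).
Implicit Types (V : set X).

Definition linear_closed_set V := forall a x y, V x -> V y -> V (a *: x + y).

(** The kernel of g in V has codimension at most one: a spanning family of it,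
    completed by one vector where g does not vanish, spans V. *)
Lemma infinite_dimensional_kernel V (g : X -> K) :
    linear_closed_set V -> infinite_dimensional V ->
    (forall a x y, g (a *: x + y) = a * g x + g y) ->
  infinite_dimensional (V `&` [set x | g x = 0]).
Proof.
move=> Vlin Vinf glin [n [e [Ve eP]]]; apply: Vinf.
have [[v0 [Vv0 gv0]]|noV] := pselect (exists v0, V v0 /\ g v0 <> 0).
  exists n.+1, (fun i => oapp e v0 (unlift ord0 i)); split=> [i|v Vv].
    by case: unliftP => [j _|_] //=; have [] := Ve j.
  pose a := g v / g v0.
  have [|c cE] := eP ((- a) *: v0 + v).
    by split=> /=; [exact: Vlin | rewrite glin /a; field; exact/eqP].
  exists (fun i => oapp c a (unlift ord0 i)).
  rewrite big_ord_recl unlift_none /=.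
  under eq_bigr do rewrite liftK /=.
  by rewrite -cE scaleNr addNKr.
exists n, e; split=> [i|v Vv]; first by have [] := Ve i.
by apply: eP; split=> //=; apply: contrapT => gv; apply: noV; exists v.
Qed.

Lemma infinite_dimensional_neq0 V :
  infinite_dimensional V -> exists2 x, V x & x <> 0.
Proof.
move=> Vinf; apply: contrapT => V0; apply: Vinf.
exists 0%N, (fun=> 0); split=> [[]//|v Vv]; exists (fun=> 0).
rewrite big_ord0; apply: contrapT => v0; apply: V0; by exists v.
Qed.

End Kernels.

(** * Mazur's step *)

Section NormedSpace.
Set Implicit Arguments.
Unset Strict Implicit.
Variables (R : realType) (k : scalar_kind).
Local Notation K := (scalar_field R k).
Variable X : normedModType K.
Implicit Types (x y z : X) (a l : K) (F : set X) (c e r : R).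

Lemma embed_rnorm x : embed R k (rnorm x) = `|x|.
Proof. exact: scalar_reK. Qed.

Lemma rnorm_ltE x e : (rnorm x < e) = (`|x| < embed R k e).
Proof. by rewrite -embed_rnorm ltr_embed. Qed.

Lemma rnorm_ge0 x : 0 <= rnorm x.
Proof. by rewrite -(ler_embed k) embed_rnorm rmorph0. Qed.

Lemma rnorm_eq0 x : rnorm x = 0 -> x = 0.
Proof. by move=> /(congr1 (embed R k)); rewrite embed_rnorm rmorph0 => /normr0_eq0. Qed.

Lemma rnorm_gt0 x : x <> 0 -> 0 < rnorm x.
Proof.
by move=> x0; rewrite lt_neqAle rnorm_ge0 andbT; apply/eqP => /esym/rnorm_eq0.
Qed.

Lemma rnormD x y : rnorm (x + y) <= rnorm x + rnorm y.
Proof. by rewrite -(ler_embed k) rmorphD /= !embed_rnorm ler_normD. Qed.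

Lemma rnormN x : rnorm (- x) = rnorm x.
Proof. by rewrite /rnorm normrN. Qed.

Lemma rnormBC x y : rnorm (x - y) = rnorm (y - x).
Proof. by rewrite -rnormN opprB. Qed.

Lemma rnormBD y x z : rnorm (x - z) <= rnorm (x - y) + rnorm (y - z).
Proof. by rewrite -(subrKA y); exact: rnormD. Qed.

Lemma rnorm_sub x y : rnorm x <= rnorm y + rnorm (x - y).
Proof. by rewrite -{1}(subrK y x) addrC; exact: rnormD. Qed.

Lemma rnormZ a x : rnorm (a *: x) = modulus a * rnorm x.
Proof.
apply: (fmorph_inj (embed R k)).
by rewrite rmorphM /= !embed_rnorm embed_modulus normrZ.
Qed.

Lemma rnorm_embedZ r x : 0 <= r -> rnorm (embed R k r *: x) = r * rnorm x.
Proof. by move=> r0; rewrite rnormZ modulus_embed ger0_norm. Qed.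

Lemma rnorm0 : rnorm (0 : X) = 0.
Proof. by rewrite -(scale0r 0) -(rmorph0 (embed R k)) rnorm_embedZ// mul0r. Qed.

Lemma rnorm_sublinear : sublinear (embed R k) (@rnorm R k X).
Proof.
split=> [|t x t0]; first exact: rnormD.
by rewrite rnorm_embedZ// ltW.
Qed.

(** Each functional cuts the space down by a kernel, which leaves an
    infinite-dimensional subspace; after finitely many it still has a nonzero
    vector. *)
Lemma exists_common_kernel (I : eqType) (f : I -> X -> R) (s : seq I) :
    infinite_dimensional [set: X] -> (forall i, real_linear (embed R k) (f i)) ->
  exists2 x, x <> 0 & forall i, i \in s -> forall a, f i (a *: x) = 0.
Proof.
move=> Xinf flin.
suff [V [Vlin Vinf Vs]] : exists V, [/\ linear_closed_set V,
    infinite_dimensional V &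
    forall x, V x -> forall i, i \in s -> forall a, f i (a *: x) = 0].
  by have [x /Vs Vx x0] := infinite_dimensional_neq0 Vinf; exists x.
elim: s => [|i s [V [Vlin Vinf Vs]]]; first by exists [set: X]; split.
have [g glin gf] := real_linear_kernel (flin i).
exists (V `&` [set x | g x = 0]); split.
- move=> a x y [Vx /= gx] [Vy /= gy]; split=> /=; first exact: Vlin.
  by rewrite glin gx gy mulr0 addr0.
- exact: infinite_dimensional_kernel.
- move=> x [Vx /= gx] j; rewrite inE => /predU1P[->|js] a; first exact: gf.
  exact: Vs.
Qed.

(** The net is taken in X rather than in F: functionals norming its points are
    defined on all of X anyway. *)
Definition balls_precompact F := forall r e, 0 < e ->
  exists s : seq X, forall x, F x -> rnorm x <= r ->
    exists2 y, y \in s & rnorm (x - y) <= e.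

(** Let f norm a net point z close to a unit vector w of F, and let f vanish on
    K x.  Then ||w + l x|| >= f (w + l x) = f w, which is close to
    f z = ||z||, hence to 1. *)
Lemma mazur_step F c :
    infinite_dimensional [set: X] -> (forall a y, F y -> F (a *: y)) ->
    balls_precompact F -> c < 1 ->
  exists x, rnorm x = 1 /\
    forall y l, F y -> c * rnorm y <= rnorm (y + l *: x).
Proof.
move=> Xinf FZ Fpre c1.
(* The mesh enters twice, in ||z|| >= ||w|| - e and in f w >= f z - e. *)
have e0 : 0 < (1 - c) / 2 by rewrite divr_gt0 ?subr_gt0.
have [s sP] := Fpre 1 _ e0.
have [f fP] := choice (fun z => hahn_banach_support z rnorm_sublinear).
have [|x0 /rnorm_gt0 x0gt0 x0P] := exists_common_kernel (f := f) s Xinf.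
  by move=> z; have [] := fP z.
pose x := embed R k (rnorm x0)^-1 *: x0.
have x1 : rnorm x = 1.
  by rewrite rnorm_embedZ ?invr_ge0 ?rnorm_ge0// mulVf// gt_eqF.
exists x; split=> // {}y l Fy.
have unit_case w l' : F w -> rnorm w = 1 -> c <= rnorm (w + l' *: x).
  move=> Fw w1; have [|z zs wz] := sP _ Fw; first by rewrite w1.
  have [[fD _] fle fz] := fP z.
  have fx : f z (l' *: x) = 0 by rewrite scalerA x0P.
  (* z = w + (z - w), and f z does not see l' *: x. *)
  have zE : f z z = f z (w + l' *: x) + f z (z - w).
    by rewrite [f z (w + _)]fD fx addr0 -fD addrC subrK.
  have := fle (w + l' *: x); have := fle (z - w); have := rnorm_sub w z.
  move: zE; rewrite fz w1 [rnorm (z - w)]rnormBC; lra.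
have [->|/eqP/rnorm_gt0 y0] := eqVneq y 0; first by rewrite rnorm0 mulr0 rnorm_ge0.
have yV : 0 <= (rnorm y)^-1 by rewrite invr_ge0 rnorm_ge0.
have := unit_case (embed R k (rnorm y)^-1 *: y) (embed R k (rnorm y)^-1 * l) (FZ _ _ Fy).
rewrite -scalerA -scalerDr !rnorm_embedZ// mulVf ?gt_eqF// => /(_ erefl).
by rewrite ler_pdivlMl// mulrC.
Qed.

Definition adjoin F x : set X := [set z | exists y l, F y /\ z = y + l *: x].

(** In a ball of F + K x both the component in F and the coefficient of x stay
    bounded, so a net is the sum of nets for the two. *)
Lemma adjoin_precompact F x c : 0 < c -> rnorm x = 1 ->
    (forall y l, F y -> c * rnorm y <= rnorm (y + l *: x)) ->
  balls_precompact F -> balls_precompact (adjoin F x).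
Proof.
move=> c0 x1 cP Fpre r e e0.
have e2 : 0 < e / 2 by rewrite divr_gt0.
have [s sP] := Fpre (r / c) _ e2.
have [t tP] := @scalar_net R k (r / c + r) _ e2.
exists [seq y + l *: x | y <- s, l <- t] => _ [y [l [Fy ->]]] ylr.
have yr : rnorm y <= r / c.
  by rewrite ler_pdivlMr// mulrC; exact: le_trans (cP _ _ Fy) ylr.
have [y' y's yy'] := sP _ Fy yr.
have [|l' l't ll'] := tP l.
  have : rnorm (l *: x) <= rnorm y + rnorm (y + l *: x).
    by have := rnorm_sub (l *: x) (- y); rewrite rnormN opprK [y + _]addrC.
  rewrite rnormZ x1; lra.
exists (y' + l' *: x); first exact: allpairs_f.
rewrite opprD addrACA -scalerBl; apply: le_trans (rnormD _ _) _.
by rewrite rnormZ x1 mulr1 [leRHS]splitr; exact: lerD.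
Qed.

Lemma adjoinZ F x : (forall a y, F y -> F (a *: y)) ->
  forall a y, adjoin F x y -> adjoin F x (a *: y).
Proof.
move=> FZ a _ [y [l [Fy ->]]]; exists (a *: y), (a * l); split; first exact: FZ.
by rewrite scalerDr scalerA.
Qed.

End NormedSpace.

(** * Basic sequences *)

Section BasicSequences.
Set Implicit Arguments.
Unset Strict Implicit.
Variables (R : realType) (k : scalar_kind).
Local Notation K := (scalar_field R k).
Variable X : normedModType K.
Implicit Types (x : nat -> X) (z : X) (a b : nat -> K) (l : K) (n m : nat).

Definition combination x a n : X := series (fun j => a j *: x j) n.

Lemma combination0 x a : combination x a 0 = 0.
Proof. by rewrite /combination /series /= big_geq. Qed.

Lemma combinationS x a n :
  combination x a n.+1 = combination x a n + a n *: x n.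
Proof. by rewrite /combination /series /= big_nat_recr. Qed.

Lemma combination_ord x a n : combination x a n = \sum_(j < n) a j *: x j.
Proof. by rewrite /combination /series /= big_mkord. Qed.

Lemma combination_linear x l a b n :
  combination x (fun j => l * a j + b j) n =
  l *: combination x a n + combination x b n.
Proof.
elim: n => [|n IH]; first by rewrite !combination0 scaler0 addr0.
by rewrite !combinationS IH scalerDr scalerDl scalerA addrACA.
Qed.

Lemma combinationB x a b n :
  combination x (fun j => a j - b j) n = combination x a n - combination x b n.
Proof.
elim: n => [|n IH]; first by rewrite !combination0 subr0.
by rewrite !combinationS IH scalerBl opprD addrACA.
Qed.

Lemma eq_combination x a b n : (forall j, (j < n)%N -> a j = b j) ->
  combination x a n = combination x b n.
Proof. by move=> ab; rewrite !combination_ord; apply: eq_bigr => j _; rewrite ab. Qed.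

Lemma combination_trunc x a n m : (n <= m)%N ->
  combination x (fun j => if (j < n)%N then a j else 0) m = combination x a n.
Proof.
elim: m => [|m IH]; first by rewrite leqn0 => /eqP->; rewrite !combination0.
rewrite leq_eqVlt => /predU1P[->|nm].
  by apply: eq_combination => j ->.
by rewrite combinationS IH// ltnNge -ltnS nm scale0r addr0.
Qed.

Lemma rnorm_combination_le x a (B : R) n :
    (forall j, modulus (a j) * rnorm (x j) <= B) ->
  rnorm (combination x a n) <= n%:R * B.
Proof.
move=> aB; elim: n => [|n IH]; first by rewrite combination0 rnorm0 mul0r.
rewrite combinationS -natr1 mulrDl mul1r; apply: le_trans (rnormD _ _) _.
by apply: lerD; rewrite // rnormZ.
Qed.

Definition basic_sequence x (C : R) :=
  (forall n, x n <> 0) /\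
  forall a n m, (n <= m)%N ->
    rnorm (combination x a n) <= C * rnorm (combination x a m).

(** Any strictly increasing sequence with values in [1, 2] would do; ratios of
    consecutive weights are the constants of the successive steps, and their
    products telescope. *)
Definition weight n : R := 2 - n.+1%:R^-1.

Lemma weight_bounds n : 1 <= weight n <= 2.
Proof.
have n0 : 0 < n.+1%:R^-1 :> R by rewrite invr_gt0.
have n1 : n.+1%:R^-1 <= 1 :> R by rewrite invf_le1// ler1n.
by move: n0 n1; rewrite /weight; move: (_^-1) => t t0 t1; apply/andP; split; lra.
Qed.

Lemma weight_lt n : weight n < weight n.+1.
Proof. by rewrite /weight ltrD2l ltrN2 ltf_pV2 ?posrE// ltr_nat. Qed.

(** Mazur's step is iterated along F 0 = 0 and F n.+1 = F n + K x_n.  The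
    invariant good is all that the step requires of F n. *)
Theorem exists_basic_sequence : infinite_dimensional [set: X] ->
  exists x, basic_sequence x 2.
Proof.
move=> Xinf.
pose c n := weight n / weight n.+1.
have w0 n : 0 < weight n by have /andP[] := weight_bounds n; lra.
have c0 n : 0 < c n by rewrite divr_gt0.
have c1 n : c n < 1 by rewrite ltr_pdivrMr// mul1r weight_lt.
pose good (F : set X) := (forall l y, F y -> F (l *: y)) /\ balls_precompact F.
have step (p : set X * nat) : exists v, good p.1 -> rnorm v = 1 /\
    forall y l, p.1 y -> c p.2 * rnorm y <= rnorm (y + l *: v).
  case: p => F n /=.
  have [[FZ Fpre]|nF] := pselect (good F); last by exists 0 => /nF.
  by have [x xP] := mazur_step Xinf FZ Fpre (c1 n); exists x.
have [pick pickP] := choice step.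
pose F := fix F n : set X :=
  if n is n'.+1 then adjoin (F n') (pick (F n', n')) else [set 0].
pose x n := pick (F n, n).
have Fgood n : good (F n).
  elim: n => [|n Fn].
    split=> [a y /= ->|r e e0]; first by rewrite scaler0.
    by exists [:: 0] => y -> _; exists 0; rewrite ?mem_head// subrr rnorm0 ltW.
  have [x1 xP] := pickP (F n, n) Fn.
  split; first exact/adjoinZ/Fn.1.
  exact: adjoin_precompact (c0 n) x1 xP Fn.2.
have F_comb a n : F n (combination x a n).
  elim: n => [|n IH]; first by rewrite combination0.
  by rewrite combinationS; exists (combination x a n), (a n).
exists x; split=> [n x0|a n m nm].
  by have [+ _] := pickP (F n, n) (Fgood n); rewrite -/(x n) x0 rnorm0 => /esym/eqP;
     rewrite oner_eq0.
have mono : weight n * rnorm (combination x a n) <=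
            weight m * rnorm (combination x a m).
  elim: m nm => [|m IH]; first by rewrite leqn0 => /eqP ->.
  rewrite leq_eqVlt => /predU1P[->//|/IH/le_trans]; apply.
  have [_ /(_ _ (a m) (F_comb a m))] := pickP (F m, m) (Fgood m).
  by rewrite -combinationS /= /c mulrAC ler_pdivrMr// [leRHS]mulrC.
have [/andP[wn _] /andP[_ wm]] := (weight_bounds n, weight_bounds m).
apply: le_trans (le_trans _ mono) _.
  by rewrite ler_peMl ?rnorm_ge0.
by rewrite ler_wpM2r ?rnorm_ge0.
Qed.

(** * The closed span of a basic sequence *)

Definition closed_span x : set X :=
  closure [set z | exists a n, z = combination x a n].

Lemma closed_spanP x z : closed_span x z <->
  forall e : R, 0 < e -> exists a n, rnorm (z - combination x a n) < e.
Proof.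
split=> [zx e e0|zx B].
  have [|_ [[a [n ->]] zn]] := zx (ball z (embed R k e)).
    by apply: nbhsx_ballx; rewrite -(rmorph0 (embed R k)) ltr_embed.
  by exists a, n; rewrite rnorm_ltE; move: zn; rewrite -ball_normE.
move=> /nbhs_ballP[e /= e0 zB].
have [|a [n an]] := zx (scalar_re e).
  by rewrite -(ltr_embed k) rmorph0 scalar_reK// ltW.
exists (combination x a n); split; first by exists a, n.
by apply: zB; rewrite -ball_normE /= -[e]scalar_reK ?(ltW e0)// -rnorm_ltE.
Qed.

Lemma expansionP x a z : expansion x a z <->
  forall e : R, 0 < e -> exists N, forall n, (N <= n)%N ->
    rnorm (z - combination x a n) < e.
Proof.
split=> [/cvgrPdist_lt az e e0|az].
  have [|N _ NP] := az (embed R k e).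
    by rewrite -(rmorph0 (embed R k)) ltr_embed.
  by exists N => n Nn; rewrite rnorm_ltE; exact: NP.
apply/cvgrPdist_lt => e e0.
have [|N NP] := az (scalar_re e).
  by rewrite -(ltr_embed k) rmorph0 scalar_reK// ltW.
exists N => // n /= Nn; have := NP n Nn.
by rewrite rnorm_ltE scalar_reK// ltW.
Qed.

Lemma expansion_linear x l a b z z' : expansion x a z -> expansion x b z' ->
  expansion x (fun j => l * a j + b j) (l *: z + z').
Proof.
move=> az bz'.
rewrite /expansion; have -> : series (fun j => (l * a j + b j) *: x j) =
    (fun n => l *: combination x a n + combination x b n).
  by apply/funext => n; exact: combination_linear.
by apply: cvgD => //; apply: cvgZr.
Qed.

(** If n vectors spanned V, the n + 1 coordinate rows of x_0, ..., x_n would be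
    dependent, and so would be these vectors. *)
Lemma infinite_dimensional_free (V : set X) x : (forall n, V (x n)) ->
    (forall a n, combination x a n = 0 -> forall j, (j < n)%N -> a j = 0) ->
  infinite_dimensional V.
Proof.
move=> Vx xfree [n [e [_ eP]]].
have [c cP] := choice (fun j => eP _ (Vx j)).
pose A : 'M[K]_(n.+1, n) := \matrix_(i, j) c i j.
have : kermx A != 0.
  by rewrite kermx_eq0 /row_free neq_ltn ltnS rank_leq_col.
move=> /rowV0Pn[u uA u0]; move/eqP: u0; apply; apply/rowP => i; rewrite mxE.
pose a j := if insub j is Some i' then u 0 i' else 0 : K.
have aE (j : 'I_n.+1) : a j = u 0 j by rewrite /a valK.
rewrite -aE; apply: (xfree a n.+1) => //.
rewrite combination_ord.
under eq_bigr do rewrite aE cP scaler_sumr.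
rewrite exchange_big /=; apply: big1 => j _.
under eq_bigr do rewrite scalerA.
rewrite -scaler_suml.
suff -> : \sum_(i < n.+1) u 0 i * c i j = (u *m A) 0 j.
  by move: uA => /sub_kermxP ->; rewrite mxE scale0r.
by rewrite mxE; apply: eq_bigr => i' _; rewrite mxE.
Qed.

Section Basis.
Variables (x : nat -> X) (C : R).
Hypothesis xC : basic_sequence x C.

(** In fact C is at least 1, as s_n is compared with itself when n = m. *)
Lemma basic_constant_ge0 : 0 <= C.
Proof.
have [x0 /(_ (fun=> 1) 1%N 1%N isT)] := xC.
rewrite combinationS combination0 add0r scale1r -ler_pdivrMr ?rnorm_gt0//.
by rewrite divff ?gt_eqF ?rnorm_gt0//; apply: le_trans.
Qed.

(** The j-th term is the difference of two consecutive partial sums. *)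
Lemma basic_sequence_coef a j m : (j < m)%N ->
  modulus (a j) * rnorm (x j) <= 2 * C * rnorm (combination x a m).
Proof.
move=> jm; rewrite -rnormZ.
have -> : a j *: x j = combination x a j.+1 - combination x a j.
  by rewrite combinationS addrAC subrr add0r.
apply: le_trans (rnormD _ _) _; rewrite rnormN mulr2n mulrDl mul1r mulrDl.
by apply: lerD; apply: xC.2 => //; exact: ltnW.
Qed.

Lemma basic_sequence_free a n : combination x a n = 0 ->
  forall j, (j < n)%N -> a j = 0.
Proof.
move=> a0 j /(basic_sequence_coef a); rewrite a0 rnorm0 mulr0 -rnormZ => ax.
have /rnorm_eq0/eqP : rnorm (a j *: x j) = 0 by apply/le_anti; rewrite ax rnorm_ge0.
by rewrite scaler_eq0 => /orP[/eqP//|/eqP/(xC.1 j)].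
Qed.

(** The bound on partial sums of combinations passes to the limit; this is the
    bound on the canonical projections, and it implies uniqueness. *)
Lemma expansion_bound a z n : expansion x a z ->
  rnorm (combination x a n) <= C * rnorm z.
Proof.
move=> /expansionP az; apply/ler_addgt0Pr => e e0.
have C1 : 0 < C + 1 by have := basic_constant_ge0; lra.
have [|N NP] := az (e / (C + 1)); first by rewrite divr_gt0.
have := NP _ (leq_maxl N n); rewrite ltr_pdivlMr//.
have := xC.2 a _ _ (leq_maxr N n); set s := combination x a (maxn N n).
have : C * rnorm s <= C * (rnorm z + rnorm (z - s)).
  by rewrite ler_wpM2l ?basic_constant_ge0// [rnorm (z - s)]rnormBC rnorm_sub.
have := rnorm_ge0 (z - s); lra.
Qed.

Lemma expansion_unique a b z : expansion x a z -> expansion x b z -> a = b.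
Proof.
move=> az bz; have := expansion_linear (l := -1) bz az.
rewrite scaleN1r addNr => d0; apply/funext => j; apply/eqP.
have : combination x (fun i => -1 * b i + a i) j.+1 = 0.
  apply/rnorm_eq0/le_anti; rewrite rnorm_ge0 andbT.
  by have := expansion_bound j.+1 d0; rewrite rnorm0 mulr0.
move=> /basic_sequence_free/(_ j (ltnSn j)).
by rewrite mulN1r addrC => /eqP; rewrite subr_eq0.
Qed.

(** Combinations within r m = 1 / (m + 1) of z are chosen for every m, with
    finitely supported coefficients b m, so that their differences are
    controlled by r m + r m'.  Coefficientwise limits a exist, and
    ||s_n (b m - a)|| <= C r m uniformly in n: the difference b m - b m' obeys
    this bound up to C r m', and for fixed n the remaining term s_n (b m' - a)
    tends to 0 with m'. *)
Lemma expansion_exists z : closed_span x z -> exists a, expansion x a z.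
Proof.
move=> /closed_spanP zx.
pose r m : R := m.+1%:R^-1.
have r0 m : 0 < r m by rewrite invr_gt0.
have rlim (u v A : R) : (forall m, u <= v + A * r m) -> u <= v.
  move=> uv; apply/ler_addgt0Pr => e e0.
  pose m := Num.truncn (`|A| / e).
  apply: le_trans (uv m) _; rewrite lerD2l.
  apply: le_trans (ler_wpM2r (ltW (r0 m)) (ler_norm A)) _.
  by rewrite ler_pdivrMr// mulrC -ler_pdivrMr// ltW// truncnS_gt.
have approx m : exists a, exists N, forall n, (N <= n)%N ->
    rnorm (z - combination x a n) <= r m.
  have [a [N aN]] := zx _ (r0 m).
  exists (fun j => if (j < N)%N then a j else 0), N => n Nn.
  by rewrite combination_trunc// ltW.
have [b bP] := choice approx.
have bB m m' j : exists2 n, (j <= n)%N &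
    rnorm (combination x (fun i => b m i - b m' i) n) <= r m + r m'.
  have [[N NP] [N' NP']] := (bP m, bP m').
  pose n := maxn j (maxn N N'); exists n; first exact: leq_maxl.
  rewrite combinationB; apply: le_trans (rnormBD z _ _) _.
  rewrite rnormBC; apply: lerD; [apply: NP|apply: NP'].
    by rewrite /n !leq_max leqnn orbT.
  by rewrite /n !leq_max leqnn !orbT.
have C0 := basic_constant_ge0.
have bcoef j : exists l, forall m,
    modulus (b m j - l) * rnorm (x j) <= 4 * C * r m.
  have xj := rnorm_gt0 (xC.1 j).
  have [|l lP] := @scalar_complete R k (b^~ j) (fun m => 2 * C * r m / rnorm (x j)).
    move=> m m'; rewrite -mulrDl ler_pdivlMr//.
    have [n jn bn] := bB m m' j.+1.
    apply: le_trans (basic_sequence_coef (fun i => b m i - b m' i) jn) _.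
    by rewrite -mulrDr ler_wpM2l ?mulr_ge0.
  exists l => m; have := lP m.
  by rewrite mulrA ler_pdivlMr// !mulrA -natrM.
have [a aP] := choice bcoef.
have ba m n : rnorm (combination x (fun i => b m i - a i) n) <= C * r m.
  (* For fixed n the error is a multiple of r m', with a factor that grows with
     n but disappears as m' tends to infinity. *)
  apply: (rlim _ _ (C + n%:R * (4 * C))) => m'.
  have [N nN bn] := bB m m' n.
  have := rnorm_combination_le n (aP ^~ m').
  have := le_trans (xC.2 _ _ _ nN) (ler_wpM2l C0 bn).
  have := rnormBD (combination x (b m') n) (combination x (b m) n) (combination x a n).
  rewrite !combinationB; lra.
exists a; apply/expansionP => e e0.
have [m me] : exists m, (1 + C) * r m < e.
  exists (Num.truncn ((1 + C) / e)).
  by rewrite /r ltr_pdivrMr// mulrC -ltr_pdivrMr// truncnS_gt.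
have [N NP] := bP m; exists N => n /NP zn; apply: le_lt_trans me.
apply: le_trans (rnormBD (combination x (b m) n) _ _) _.
by rewrite mulrDl mul1r lerD// -combinationB.
Qed.

Lemma closed_span_closed_subspace : closed_subspace (closed_span x).
Proof.
split; last exact: closed_closure.
split=> [|l u v]; rewrite !inE.
  by apply: subset_closure; exists (fun=> 0), 0%N; rewrite combination0.
move=> /expansion_exists[a au] /expansion_exists[b bv].
apply/closed_spanP => e e0.
have /expansionP/(_ _ e0)[N NP] := expansion_linear (l := l) au bv.
by exists (fun j => l * a j + b j), N; apply: NP.
Qed.

Lemma closed_span_combination a n : closed_span x (combination x a n).
Proof. by apply: subset_closure; exists a, n. Qed.

Lemma closed_span_basis : schauder_basis (closed_span x) x.
Proof.
split=> [n|z /expansion_exists[a az]].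
  apply: subset_closure; exists (fun j => (j == n)%:R), n.+1.
  rewrite combinationS eqxx scale1r combination_ord big1 ?add0r// => j _.
  by rewrite ltn_eqF// scale0r.
exists a; split=> // b; exact: expansion_unique.
Qed.

Lemma coordinatesP z : closed_span x z -> expansion x (coordinates x z) z.
Proof. by move=> /expansion_exists/getPex. Qed.

Lemma canonical_projectionE n z :
  canonical_projection x n z = combination x (coordinates x z) n.+1.
Proof. by rewrite combination_ord. Qed.

Lemma canonical_projection_bound n z : closed_span x z ->
  rnorm (canonical_projection x n z) <= C * rnorm z.
Proof.
by move=> /coordinatesP zx; rewrite canonical_projectionE; exact: expansion_bound.
Qed.

Lemma canonical_projection_bounded n :
  bounded_operator_on (closed_span x) (canonical_projection x n).
Proof.
split=> [z _|l u v xu xv|].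
- by rewrite canonical_projectionE; exact: closed_span_combination.
- rewrite !canonical_projectionE -combination_linear; congr combination.
  have [_ linx] := closed_span_closed_subspace.1.
  apply: expansion_unique (coordinatesP _) _; last first.
    by apply: expansion_linear; exact: coordinatesP.
  by have := linx l u v; rewrite !inE; apply.
- by exists C => z; exact: canonical_projection_bound.
Qed.

Lemma canonical_projection_norm n :
  (operator_norm_on (closed_span x) (canonical_projection x n) <= C%:E)%E.
Proof.
apply: ge_ereal_sup => _ [z [xz z1] <-]; rewrite lee_fin.
apply: le_trans (canonical_projection_bound n xz) _.
by rewrite ler_piMr// basic_constant_ge0.
Qed.

End Basis.
End BasicSequences.

Theorem theorem2p3 (R : realType) (k : scalar_kind)
    (X : normedModType (scalar_field R k)) :
  infinite_dimensional [set: X] ->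
  exists (Z : set X) (x : nat -> X),
    [/\ closed_subspace Z,
        infinite_dimensional Z,
        schauder_basis Z x,
        forall n : nat, bounded_operator_on Z (canonical_projection x n) &
        (ereal_sup (range (fun n : nat =>
           operator_norm_on Z (canonical_projection x n))) < +oo)%E].
Proof.
move=> /exists_basic_sequence[x xC]; exists (closed_span x), x; split.
- exact: closed_span_closed_subspace xC.
- exact: infinite_dimensional_free (closed_span_basis xC).1 (basic_sequence_free xC).
- exact: closed_span_basis xC.
- exact: canonical_projection_bounded xC.
- apply: (@le_lt_trans _ _ 2%:E); last exact: ltry.
  by apply: ge_ereal_sup => _ [n _ <-]; exact: canonical_projection_norm xC n.
Qed.
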